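(* Let $\mathbf C_k,\mathbf D_k\in\mathbb C^{LM\times LM}$ ($k=1,\dots,K$) and $\mathbf X_i\in\mathbb C^{LM\times LM}$ ($i=1,\dots,LM$) be the matrices defined in the context, and let $R_\Sigma>0$, $\mu\ge0$, $\tau=(LM)^{-1}$, $\alpha_1>0$, $\alpha_2>0$ be given constants. For nonzero $\mathbf w\in\mathbb C^{LM}$ let $$\lambda_{\sf RIS}(\mathbf w)=\prod_{k=1}^K\left(\frac{\mathbf w^{\sf H}\mathbf C_k\mathbf w}{\mathbf w^{\sf H}\mathbf D_k\mathbf w}\right)^{\frac1{R_\Sigma}}\left(\sum_{i=1}^{LM}\exp\left(\frac{\mathbf w^{\sf H}\mathbf X_i\mathbf w}{\alpha_1}\right)\right)^{-\frac{\alpha_1\mu\ln2}{\tau}}\left(\sum_{i=1}^{LM}\exp\left(\frac{\mathbf w^{\sf H}\mathbf X_i\mathbf w}{-\alpha_2}\right)\right)^{-\frac{\alpha_2\mu\ln2}{\tau}}$$ and $\tilde{\mathcal L}_{\sf RIS}(\mathbf w)=\log_2\lambda_{\sf RIS}(\mathbf w)$. Let $\lambda_{{\sf RIS},{\sf num}}$ and $\lambda_{{\sf RIS},{\sf den}}$ be any scalar functions of $\mathbf w$ with $\lambda_{\sf RIS}(\mathbf w)=\lambda_{{\sf RIS},{\sf num}}(\mathbf w)/\lambda_{{\sf RIS},{\sf den}}(\mathbf w)$, and set $$\bar{\mathbf C}(\mathbf w)=\lambda_{{\sf RIS},{\sf num}}(\mathbf w)\left[\frac1{R_\Sigma\ln2}\sum_{k=1}^K\frac{\mathbf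 C_k}{\mathbf w^{\sf H}\mathbf C_k\mathbf w}+\frac\mu\tau\,\frac{\sum_{i=1}^{LM}\mathbf X_i e^{-\mathbf w^{\sf H}\mathbf X_i\mathbf w/\alpha_2}}{\sum_{i=1}^{LM}e^{-\mathbf w^{\sf H}\mathbf X_i\mathbf w/\alpha_2}}\right],$$ $$\bar{\mathbf D}(\mathbf w)=\lambda_{{\sf RIS},{\sf den}}(\mathbf w)\left[\frac1{R_\Sigma\ln2}\sum_{k=1}^K\frac{\mathbf D_k}{\mathbf w^{\sf H}\mathbf D_k\mathbf w}+\frac\mu\tau\,\frac{\sum_{i=1}^{LM}\mathbf X_i e^{\mathbf w^{\sf H}\mathbf X_i\mathbf w/\alpha_1}}{\sum_{i=1}^{LM}e^{\mathbf w^{\sf H}\mathbf X_i\mathbf w/\alpha_1}}\right].$$ Then the stationarity condition $\partial\tilde{\mathcal L}_{\sf RIS}(\mathbf w)/\partial\mathbf w^{\sf H}=\mathbf 0$ of the problem of maximizing $\tilde{\mathcal L}_{\sf RIS}$ over $\mathbf w$ is satisfied at $\mathbf w$ if $$\bar{\mathbf D}^{-1}(\mathbf w)\,\bar{\mathbf C}(\mathbf w)\,\mathbf w=\lambda_{\sf RIS}(\mathbf w)\,\mathbf w.$$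
   Context: Let $N,K,L,M\ge1$ be integers and $\sigma^2>0$, $P>0$ scalars. For $k=1,\dots,K$ and $\ell=1,\dots,L$ let $\hat{\mathbf H}^{\sf r}_{k,\ell}\in\mathbb C^{N\times M}$ be given matrices (channel estimates), $\mathbf R^{\sf e}_{k,\ell}\in\mathbb C^{NM\times NM}$ given Hermitian positive semidefinite matrices (error covariances), and $\mathbf f_1,\dots,\mathbf f_K\in\mathbb C^N$ given vectors (fixed precoders). Let $\mathbf P$ be the $NM\times NM$ permutation matrix with $\mathrm{vec}(\mathbf E^{\sf T})=\mathbf P\,\mathrm{vec}(\mathbf E)$ for all $\mathbf E\in\mathbb C^{N\times M}$ (not to be confused with the scalar power $P$). Define $$\boldsymbol\Theta_{k,\ell}=\sum_{i=1}^K(\mathbf f_i^{\sf T}\otimes\mathbf I_M)\,\mathbf P\,(\mathbf R^{\sf e}_{k,\ell})^{*}\,\mathbf P^{\sf T}\,(\mathbf f_i^{\sf T}\otimes\mathbf I_M)^{\sf H},$$ $$\mathbf Q=\sum_{i=1}^K\mathbf f_i\mathbf f_i^{\sf H},\quad \bar{\mathbf Q}_k=\mathbf Q-\mathbf f_k\mathbf f_k^{\sf H},\quad \Upsilon_{k,\ell}=(\hat{\mathbf H}^{\sf r}_{k,\ell})^{\sf H}\mathbf Q\,\hat{\mathbf H}^{\sf r}_{k,\ell},\quad \bar\Upsilon_{k,\ell}=(\hat{\mathbf H}^{\sf r}_{k,\ell})^{\sf H}\bar{\mathbf Q}_k\,\hat{\mathbf H}^{\sf r}_{k,\ell},$$ $$\mathbf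 C_k=LM\,\mathrm{blkdiag}\left(\Upsilon_{k,1}+\boldsymbol\Theta_{k,1},\dots,\Upsilon_{k,L}+\boldsymbol\Theta_{k,L}\right)+\frac{\sigma^2}{P}\mathbf I_{LM},$$ $$\mathbf D_k=LM\,\mathrm{blkdiag}\left(\bar\Upsilon_{k,1}+\boldsymbol\Theta_{k,1},\dots,\bar\Upsilon_{k,L}+\boldsymbol\Theta_{k,L}\right)+\frac{\sigma^2}{P}\mathbf I_{LM},$$ and $\mathbf X_i=\mathrm{diag}(0,\dots,0,1,0,\dots,0)$, the $LM\times LM$ diagonal matrix whose only nonzero entry is a $1$ in the $i$-th diagonal position. Here $(\cdot)^*$ is entrywise complex conjugation, $(\cdot)^{\sf T}$ transpose, $(\cdot)^{\sf H}$ conjugate transpose. The variable $\mathbf w$ is the normalized stacked vector of RIS phase shifts, with the unit-modulus constraint relaxed; $\mu$ is a regularization parameter, $\tau,R_\Sigma$ are normalization factors and $\alpha_1,\alpha_2$ are smoothing parameters. For a real-valued function of a complex vector, $\partial/\partial\mathbf w^{\sf H}$ denotes the (Wirtinger) gradient with respect to the conjugate variable; its vanishing is equivalent to vanishing of the real gradient in real and imaginary parts (a constant scaling convention is immaterial). *)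

(* Defs.v *)
(* MathComp / MathComp-Analysis; complex numbers are R[i] over R : realType. *)
From HB Require Import structures.
From mathcomp Require Import all_boot all_order all_algebra.
From mathcomp Require Import sesquilinear spectral.
From mathcomp Require Import complex mxtens.
From mathcomp Require Import all_classical all_reals all_analysis.

Set Implicit Arguments.
Unset Strict Implicit.
Unset Printing Implicit Defensive.

Import Order.TTheory GRing.Theory Num.Theory numFieldNormedType.Exports.
Local Open Scope ring_scope.
Local Open Scope complex_scope.
Local Open Scope sesquilinear_scope.

Section LinearAlgebra.
Context {R : realType}.
Local Notation C := R[i].

Definition psdmx n (A : 'M[C]_n) : Prop :=
  A \is hermsymmx /\ forall v : 'cV[C]_n, 0 <= (v ^t* *m A *m v) 0 0.

(* Column-stacking vectorization, in the index convention of [tensmx]. *)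
Definition vec m n (E : 'M[C]_(m, n)) : 'cV[C]_(n * m) :=
  \col_q E (mxtens_unindex q).2 (mxtens_unindex q).1.

(* The sizes m * n and n * m are equal but not convertible, so the
   permutation matrix is typed as an (m * n) x (n * m) matrix. *)
Definition commutation_mx m n : 'M[C]_(m * n, n * m) :=
  \matrix_(p, q) (mxtens_unindex q ==
                  ((mxtens_unindex p).2, (mxtens_unindex p).1))%:R.

Lemma vec_trmx m n (E : 'M[C]_(m, n)) :
  vec E^T = commutation_mx m n *m vec E.
Proof.
apply/colP => p; rewrite !mxE.
rewrite (bigD1 (mxtens_index ((mxtens_unindex p).2, (mxtens_unindex p).1))) //=.
rewrite !mxE mxtens_indexK eqxx mul1r big1 ?addr0 // => q qp.
rewrite !mxE; case: eqP => [e|_]; last by rewrite mul0r.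
by move: qp; rewrite -e mxtens_unindexK eqxx.
Qed.

Lemma blkdiag_size L M : (\sum_(l < L) M = L * M)%N.
Proof. by rewrite sum_nat_const card_ord. Qed.

Definition blkdiag L M (B : 'I_L -> 'M[C]_M) : 'M[C]_(L * M) :=
  castmx (blkdiag_size L M, blkdiag_size L M) (\mxdiag_(l < L) B l).

(* The real number w^H A w; taking the real part loses nothing when A is
   Hermitian, see [qformE]. *)
Definition qform n (A : 'M[C]_n) (w : 'cV[C]_n) : R :=
  complex.Re ((w ^t* *m A *m w) 0 0).

Lemma qformE n (A : 'M[C]_n) (w : 'cV[C]_n) : A \is hermsymmx ->
  (qform A w)%:C = (w ^t* *m A *m w) 0 0.
Proof.
rewrite is_hermitianmxE expr0 scale1r => /eqP hA.
rewrite /qform; set z := _ 0 0.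
have hz : z^* = z.
  have -> : z^* = ((w ^t* *m A *m w) ^t*) 0 0 by rewrite [RHS]mxE mxE.
  by rewrite !trmx_mul !map_mxM /= trmxCK mulmxA -hA.
by rewrite RRe_real // CrealE; apply/eqP.
Qed.

End LinearAlgebra.

Section ChannelMatrices.
Context {R : realType} (N K L M : nat).
Local Notation C := R[i].
Variables (sigma2 P : R) (H : 'I_K -> 'I_L -> 'M[C]_(N, M)).
Variables (Rerr : 'I_K -> 'I_L -> 'M[C]_(M * N)) (f : 'I_K -> 'cV[C]_N).

Definition kron_f (i : 'I_K) : 'M[C]_(M, N * M) :=
  castmx (mul1n M, erefl (N * M)%N) ((f i)^T *t 1%:M).

Definition Theta (k : 'I_K) (l : 'I_L) : 'M[C]_M :=
  \sum_(i < K) kron_f i *m commutation_mx N M *m map_mx Num.conj (Rerr k l)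
               *m (commutation_mx N M)^T *m (kron_f i) ^t*.

Definition Qmx : 'M[C]_N := \sum_(i < K) f i *m (f i) ^t*.

Definition Qbar (k : 'I_K) : 'M[C]_N := Qmx - f k *m (f k) ^t*.

Definition Upsilon (k : 'I_K) (l : 'I_L) : 'M[C]_M :=
  (H k l) ^t* *m Qmx *m H k l.

Definition Upsilonbar (k : 'I_K) (l : 'I_L) : 'M[C]_M :=
  (H k l) ^t* *m Qbar k *m H k l.

Definition Cmx (k : 'I_K) : 'M[C]_(L * M) :=
  (L * M)%:R *: blkdiag (fun l => Upsilon k l + Theta k l)
  + ((sigma2 / P)%:C)%:M.

Definition Dmx (k : 'I_K) : 'M[C]_(L * M) :=
  (L * M)%:R *: blkdiag (fun l => Upsilonbar k l + Theta k l)
  + ((sigma2 / P)%:C)%:M.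

End ChannelMatrices.

Definition Xmx (R : realType) n (i : 'I_n) : 'M[R[i]]_n := diag_mx (delta_mx 0 i).
Arguments Xmx {R n} i.

Section Objective.
Context {R : realType} (K n : nat).
Local Notation C := R[i].
Variables (CC DD : 'I_K -> 'M[C]_n) (RS mu tau a1 a2 : R).

Definition lambdaRIS (w : 'cV[C]_n) : R :=
  (\prod_(k < K) (qform (CC k) w / qform (DD k) w) `^ RS^-1)
  * (\sum_(i < n) expR (qform (Xmx i) w / a1)) `^ (- (a1 * mu * ln 2 / tau))
  * (\sum_(i < n) expR (qform (Xmx i) w / - a2)) `^ (- (a2 * mu * ln 2 / tau)).

Definition LRIS (w : 'cV[C]_n) : R := ln (lambdaRIS w) / ln 2.

Definition Cbar (num : 'cV[C]_n -> C) (w : 'cV[C]_n) : 'M[C]_n :=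
  num w *:
    (((RS * ln 2)^-1)%:C *: \sum_(k < K) ((qform (CC k) w)^-1)%:C *: CC k
     + (mu / tau)%:C *:
       (((\sum_(i < n) expR (- qform (Xmx i) w / a2))^-1)%:C *:
         \sum_(i < n) (expR (- qform (Xmx i) w / a2))%:C *: Xmx i)).

Definition Dbar (den : 'cV[C]_n -> C) (w : 'cV[C]_n) : 'M[C]_n :=
  den w *:
    (((RS * ln 2)^-1)%:C *: \sum_(k < K) ((qform (DD k) w)^-1)%:C *: DD k
     + (mu / tau)%:C *:
       (((\sum_(i < n) expR (qform (Xmx i) w / a1))^-1)%:C *:
         \sum_(i < n) (expR (qform (Xmx i) w / a1))%:C *: Xmx i)).

End Objective.

Section Wirtinger.
Context {R : realType} (n : nat).
Local Notation C := R[i].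
Implicit Types (g : 'cV[C]_n -> R) (w : 'cV[C]_n).

(* g as a function of the pair (x, y), where w = x + i y. *)
Definition real_coord g (p : 'cV[R]_n * 'cV[R]_n) : R :=
  g (\col_j (p.1 j 0 +i* p.2 j 0)).

Definition reim w : 'cV[R]_n * 'cV[R]_n :=
  (map_mx (@complex.Re R) w, map_mx (@complex.Im R) w).

(* Entry j is (1/2) (dg/dx_j + i dg/dy_j). *)
Definition wirtinger_grad g w : 'cV[C]_n :=
  \col_j (2^-1 * ('D_(delta_mx j 0, 0) (real_coord g) (reim w)
                   +i* 'D_(0, delta_mx j 0) (real_coord g) (reim w))).

(* Since 'D_v is a total operator, differentiability in the real sense has to
   be required for the vanishing of the gradient to be meaningful. *)
Definition wirtinger_stationary g w : Prop :=
  differentiable (real_coord g) (reim w) /\ wirtinger_grad g w = 0.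

End Wirtinger.

(* Main.v *)
(* For Hermitian A the real differential of w^H A w in the direction h is
   2 Re (h^H A w).  Writing C1 and D1 for the brackets in Cbar and Dbar,
   logarithmic differentiation of the product lambda gives
   d(ln lambda)(h) = 2 ln 2 Re (h^H (C1 - D1) w).  All C_k and D_k are positive
   definite, being positive semidefinite plus a positive multiple of I, so
   lambda > 0, hence num and den do not vanish at w, and D1 is positive definite,
   hence Dbar is invertible.  The eigenvalue equation then reads
   num C1 w = lambda den D1 w = num D1 w, that is (C1 - D1) w = 0. *)
From HB Require Import structures.
Require Import Defs.
From mathcomp Require Import all_boot all_order all_algebra.
From mathcomp Require Import sesquilinear spectral.
From mathcomp Require Import complex mxtens.
From mathcomp Require Import all_classical all_reals all_analysis.
From mathcomp Require Import ring.

Set Implicit Arguments.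
Unset Strict Implicit.
Unset Printing Implicit Defensive.

Import Order.TTheory GRing.Theory Num.Theory numFieldNormedType.Exports.
Local Open Scope ring_scope.
Local Open Scope complex_scope.

(** * Closure properties of positive semidefinite and positive definite complex matrices *)

Section PositiveSemidefinite.
Local Open Scope sesquilinear_scope.
Context {R : realType}.
Local Notation C := R[i].

Lemma trmxC_mul m n p (A : 'M[C]_(m, n)) (B : 'M[C]_(n, p)) :
  (A *m B) ^t* = B ^t* *m A ^t*.
Proof. by rewrite trmx_mul map_mxM. Qed.

Lemma hermsymmxP n (A : 'M[C]_n) : A \is hermsymmx <-> A ^t* = A.
Proof.
rewrite is_hermitianmxE expr0 scale1r; split=> [/eqP/esym //|hA].
by apply/eqP; rewrite hA.
Qed.

Lemma psdmx0 n : psdmx (0 : 'M[C]_n).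
Proof.
split; first by apply/hermsymmxP; rewrite trmx0 map_mx0.
by move=> v; rewrite mulmx0 mul0mx mxE.
Qed.

Lemma psdmxD n (A B : 'M[C]_n) : psdmx A -> psdmx B -> psdmx (A + B).
Proof.
move=> [/hermsymmxP hA pA] [/hermsymmxP hB pB]; split.
  by apply/hermsymmxP; rewrite linearD map_mxD /= hA hB.
by move=> v; rewrite mulmxDr mulmxDl mxE addr_ge0.
Qed.

Lemma psdmx_sum (I : Type) (r : seq I) (Q : pred I) n (A : I -> 'M[C]_n) :
  (forall i, Q i -> psdmx (A i)) -> psdmx (\sum_(i <- r | Q i) A i).
Proof. by move=> h; elim/big_rec: _ => [|i B /h]; [exact: psdmx0|exact: psdmxD]. Qed.

Lemma psdmxZ n (c : R) (A : 'M[C]_n) : 0 <= c -> psdmx A -> psdmx (c%:C *: A).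
Proof.
move=> c0 [/hermsymmxP hA pA]; split.
  apply/hermsymmxP; rewrite linearZ /= map_mxZ hA.
  by congr (_ *: _); exact: conjc_real.
by move=> v; rewrite -scalemxAr -scalemxAl mxE mulr_ge0 ?ler0c.
Qed.

(** The form of [B A B^H] at [v] is the form of [A] at [B^H v]. *)
Lemma psdmx_congr m n (B : 'M[C]_(m, n)) (A : 'M[C]_n) :
  psdmx A -> psdmx (B *m A *m B ^t*).
Proof.
move=> [/hermsymmxP hA pA]; split.
  by apply/hermsymmxP; rewrite !trmxC_mul trmxCK hA mulmxA.
move=> v; have := pA (B ^t* *m v).
by rewrite trmxC_mul trmxCK !mulmxA.
Qed.

(** The form of the conjugate of [A] at [v] is the conjugate of the form of [A] at the conjugate of
    [v], and conjugation preserves nonnegativity. *)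
Lemma psdmx_conj n (A : 'M[C]_n) : psdmx A -> psdmx (map_mx Num.conj A).
Proof.
move=> [/hermsymmxP hA pA]; split.
  by apply/hermsymmxP; rewrite map_trmx hA.
move=> v; have conjK p q (B : 'M[C]_(p, q)) : map_mx Num.conj (map_mx Num.conj B) = B.
  by apply/matrixP=> i j; rewrite !mxE conjCK.
have -> : v ^t* *m map_mx Num.conj A *m v =
    map_mx Num.conj ((map_mx Num.conj v) ^t* *m A *m map_mx Num.conj v).
  by rewrite 2!map_mxM map_trmx !conjK.
by rewrite mxE conj_ge0.
Qed.

Lemma psdmx1 n : psdmx (1%:M : 'M[C]_n).
Proof.
split; first by apply/hermsymmxP; rewrite trmx1 map_mx1.
move=> v; rewrite mulmx1 mxE sumr_ge0 // => i _.
by rewrite !mxE mulrC mul_conjC_ge0.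
Qed.

Lemma psdmx_gram m n (B : 'M[C]_(m, n)) : psdmx (B *m B ^t*).
Proof. by rewrite -{1}[B]mulmx1; apply: psdmx_congr; exact: psdmx1. Qed.

(** Cutting [v] into blocks turns the form into the sum of the forms of the diagonal blocks. *)
Lemma psdmx_mxdiag L (p : 'I_L -> nat) (B : forall l, 'M[C]_(p l)) :
  (forall l, psdmx (B l)) -> psdmx (\mxdiag_(l < L) B l).
Proof.
move=> hB; split.
  apply/hermsymmxP; rewrite tr_mxdiag.
  have -> : map_mx Num.conj (\mxdiag_l (B l)^T) = \mxdiag_l (B l) ^t*.
    (* [\mxdiag] is a [\mxblock] whose diagonal entries pass through [conform_mx] to fit the size
       [p i] by [p j]; conjugation is pushed inside block by block. *)
    transitivity (\mxblock_(i, j) map_mx Num.conj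
        (if i == j then conform_mx 0 (B i)^T else 0 : 'M[C]_(p i, p j))).
      by apply/matrixP=> i j; rewrite !mxE.
    apply/eq_mxblock => i j.
    by case: eqVneq => _; rewrite ?map_conform_mx map_mx0.
  by apply: eq_mxdiag => l; have [/hermsymmxP ->] := hB l.
move=> v; rewrite -(submxcolK v).
have -> : (\mxcol_i submxcol v i) ^t* = \mxrow_i (submxcol v i) ^t*.
  by rewrite tr_mxcol; apply/matrixP=> i j; rewrite !mxE.
rewrite mul_mxrow_mxdiag mul_mxrow_mxcol summxE sumr_ge0 // => l _.
by case: (hB l).
Qed.

Lemma psdmx_castmx m n (e : m = n) (A : 'M[C]_m) :
  psdmx A -> psdmx (castmx (e, e) A).
Proof. by case: _ / e; rewrite castmx_id. Qed.

Lemma psdmx_blkdiag L M (B : 'I_L -> 'M[C]_M) :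
  (forall l, psdmx (B l)) -> psdmx (blkdiag B).
Proof. by move=> hB; apply: psdmx_castmx; exact: psdmx_mxdiag. Qed.

Lemma qform_ge0 n (A : 'M[C]_n) w : psdmx A -> 0 <= qform A w.
Proof. by move=> [_ /(_ w)]; rewrite lecE => /andP[]. Qed.

Lemma ReD (x y : C) : complex.Re (x + y) = complex.Re x + complex.Re y.
Proof. by case: x; case: y. Qed.

Lemma Re_sum (I : Type) (r : seq I) (Q : pred I) (F : I -> C) :
  complex.Re (\sum_(i <- r | Q i) F i) = \sum_(i <- r | Q i) complex.Re (F i).
Proof. by apply: big_morph => //; exact: ReD. Qed.

Lemma ReMl (c : R) (x : C) : complex.Re (c%:C * x) = c * complex.Re x.
Proof. by case: x => a b /=; rewrite mul0r subr0. Qed.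

(** Polarized version of [qform]: [pform A w w] is convertible to [qform A w], and for Hermitian [A]
    the differential of [qform A] at [w] is [2 * pform A h w]. *)
Definition pform n (A : 'M[C]_n) (u v : 'cV[C]_n) : R :=
  complex.Re ((u ^t* *m A *m v) 0 0).

Lemma pformD n (A B : 'M[C]_n) u v : pform (A + B) u v = pform A u v + pform B u v.
Proof. by rewrite /pform mulmxDr mulmxDl mxE ReD. Qed.

Lemma pformZ n (c : R) (A : 'M[C]_n) u v : pform (c%:C *: A) u v = c * pform A u v.
Proof. by rewrite /pform -scalemxAr -scalemxAl mxE ReMl. Qed.

Lemma pform0 n (u v : 'cV[C]_n) : pform 0 u v = 0.
Proof. by rewrite /pform mulmx0 mul0mx mxE. Qed.

Lemma pform_sum (I : Type) (r : seq I) n (A : I -> 'M[C]_n) u v :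
  pform (\sum_(i <- r) A i) u v = \sum_(i <- r) pform (A i) u v.
Proof.
by apply: (big_morph (fun A => pform A u v)) => [A1 A2|]; rewrite (pformD, pform0).
Qed.

(** The form sees [A] only through [A v]; this is how a vector equation such as [C1 w = D1 w]
    reaches the derivative. *)
Lemma pform_eqr n (A B : 'M[C]_n) u v : A *m v = B *m v -> pform A u v = pform B u v.
Proof. by move=> AB; rewrite /pform -mulmxA AB mulmxA. Qed.

(** For Hermitian [A], exchanging the arguments conjugates the value, which leaves the real part
    unchanged. *)
Lemma pform_sym n (A : 'M[C]_n) u v : A \is hermsymmx -> pform A u v = pform A v u.
Proof.
move=> /hermsymmxP hA; rewrite /pform.
have -> : (u ^t* *m A *m v) 0 0 = ((v ^t* *m A *m u) 0 0)^*.
  have -> : u ^t* *m A *m v = (v ^t* *m A *m u) ^t*.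
    by rewrite !trmxC_mul trmxCK hA mulmxA.
  by rewrite !mxE.
by case: (_ 0 0).
Qed.

Lemma qform1_gt0 n (w : 'cV[C]_n) : w != 0 -> 0 < qform 1%:M w.
Proof.
move=> w0; rewrite lt_neqAle qform_ge0 ?andbT; last exact: psdmx1.
apply: contraNneq w0 => h0; have := qformE w (psdmx1 n).1.
rewrite -h0 mulmx1 mxE => /esym h.
apply/eqP/colP => i; rewrite [RHS]mxE.
have hp (j : 'I_n) : true -> 0 <= (w ^t*) 0 j * w j 0.
  by rewrite !mxE mulrC mul_conjC_ge0.
(* A vanishing sum of the nonnegative terms [|w_j|^2] forces each term to vanish. *)
have /allP/(_ i) : all (fun j => true ==> ((w ^t*) 0 j * w j 0 == 0)) (index_enum 'I_n).
  by rewrite -psumr_eq0 // h.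
rewrite mem_index_enum => /(_ isT) /=.
by rewrite !mxE mulrC mul_conjC_eq0 => /eqP.
Qed.

Definition posdefmx n (A : 'M[C]_n) : Prop :=
  A \is hermsymmx /\ forall w, w != 0 -> 0 < qform A w.

Lemma posdefmx_shift n (A : 'M[C]_n) (c : R) :
  psdmx A -> 0 < c -> posdefmx (A + c%:C%:M).
Proof.
move=> hA c0; rewrite -scalemx1; split.
  suff [] : psdmx (A + c%:C *: 1%:M) by [].
  apply: psdmxD hA _; apply: psdmxZ (ltW c0) _; exact: psdmx1.
move=> w w0; rewrite /qform -/(pform _ w w) pformD pformZ.
by apply: ltr_wpDl; [exact: qform_ge0|apply: mulr_gt0 => //; exact: qform1_gt0].
Qed.

(** A nonzero [v] with [A v = 0] would give the form the value 0. *)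
Lemma unitmx_qform_gt0 n (A : 'M[C]_n) :
  (forall v, v != 0 -> 0 < qform A v) -> A \in unitmx.
Proof.
(* [kermx] is a left kernel, so the argument runs on the transpose: a row [u] of [kermx A^T] yields
   the column [u^T] killed by [A]. *)
move=> hA; rewrite -unitmx_tr -row_free_unit -kermx_eq0; apply/eqP/row_matrixP => i.
rewrite row0; set u := row i _.
have uA : u *m A^T = 0 by rewrite /u -row_mul mulmx_ker row0.
have Au : A *m u^T = 0 by rewrite -[A]trmxK -trmx_mul uA trmx0.
apply/eqP; apply: contraT => u0.
have := hA u^T; rewrite trmx_eq0 => /(_ u0).
by rewrite /qform -mulmxA Au mulmx0 mxE ltxx.
Qed.

End PositiveSemidefinite.

(** * Positive definiteness of the channel matrices [C_k] and [D_k] *)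

Section ChannelMatricesPositive.
Local Open Scope sesquilinear_scope.
Context {R : realType} (N K L M : nat).
Local Notation C := R[i].
Variables (sigma2 P : R) (H : 'I_K -> 'I_L -> 'M[C]_(N, M)).
Variables (Rerr : 'I_K -> 'I_L -> 'M[C]_(M * N)) (f : 'I_K -> 'cV[C]_N).
Hypothesis Rerr_psd : forall k l, psdmx (Rerr k l).

Lemma psdmx_Theta k l : psdmx (Theta Rerr f k l).
Proof.
apply: psdmx_sum => i _; move: (kron_f M f i) (psdmx_conj (Rerr_psd k l)) => B.
(* The permutation matrix is real, so its transpose is its adjoint and each summand becomes two
   nested congruences of the conjugated covariance. *)
have <- : (commutation_mx N M) ^t* = (commutation_mx N M)^T :> 'M[C]_(_, _).
  by apply/matrixP=> p q; rewrite !mxE conjC_nat.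
move: (commutation_mx N M) (map_mx _ _) => A E /(psdmx_congr A)/(psdmx_congr B).
by rewrite !mulmxA.
Qed.

Lemma psdmx_Upsilon k l : psdmx (Upsilon H f k l).
Proof.
rewrite /Upsilon -{2}[H k l]trmxCK; apply: psdmx_congr.
by apply: psdmx_sum => i _; exact: psdmx_gram.
Qed.

Lemma psdmx_Upsilonbar k l : psdmx (Upsilonbar H f k l).
Proof.
rewrite /Upsilonbar -{2}[H k l]trmxCK; apply: psdmx_congr.
(* Subtracting [f_k f_k^H] cancels the [k]-th summand of [Q], leaving a sum of Gram matrices over
   the other indices. *)
rewrite /Qbar /Qmx (bigD1 k isT) addrAC subrr add0r.
by apply: psdmx_sum => i _; exact: psdmx_gram.
Qed.

Hypotheses (sigma2_gt0 : 0 < sigma2) (P_gt0 : 0 < P).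

Lemma psdmx_scaled_blkdiag (B : 'I_L -> 'M[C]_M) :
  (forall l, psdmx (B l)) -> psdmx ((L * M)%:R *: blkdiag B).
Proof.
move=> hB.
have -> : (L * M)%:R = ((L * M)%:R : R)%:C :> C by rewrite rmorph_nat.
by apply: psdmxZ; [exact: ler0n|exact: psdmx_blkdiag].
Qed.

Lemma posdefmx_Cmx k : posdefmx (Cmx sigma2 P H Rerr f k).
Proof.
apply: posdefmx_shift; last exact: divr_gt0.
apply: psdmx_scaled_blkdiag => l.
exact: psdmxD (psdmx_Upsilon k l) (psdmx_Theta k l).
Qed.

Lemma posdefmx_Dmx k : posdefmx (Dmx sigma2 P H Rerr f k).
Proof.
apply: posdefmx_shift; last exact: divr_gt0.
apply: psdmx_scaled_blkdiag => l.
exact: psdmxD (psdmx_Upsilonbar k l) (psdmx_Theta k l).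
Qed.

End ChannelMatricesPositive.

(** * Calculus of differentials and logarithmic differentials *)

Section Differentials.
Context {R : realType} {V : normedModType R}.
Implicit Types (p : V) (g d : V -> R).

(** A continuous linear map is its own differential. The linear structure is packed on the spot so
    that bare functions, such as coordinate projections, qualify. *)
Lemma is_diff_linear (W : normedModType R) (f : V -> W) p :
  linear f -> continuous f -> is_diff p f f.
Proof.
move=> lf cf; pose fM := GRing.isLinear.Build _ _ _ _ _ lf.
pose F : {linear V -> W} := HB.pack f fM.
by split; [exact: (linear_differentiable (f := F))|exact: (diff_lin (f := F))].
Qed.

Lemma is_diff_sum (I : Type) (r : seq I) p (g d : I -> V -> R) :
  (forall i, is_diff p (g i) (d i)) ->
  is_diff p (fun q => \sum_(i <- r) g i q) (fun h => \sum_(i <- r) d i h).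
Proof.
move=> hg; elim: r => [|i r IH].
  have -> : (fun q => \sum_(i <- [::]) g i q) = cst 0.
    by apply: funext => q; rewrite big_nil.
  have -> : (fun h => \sum_(i <- [::]) d i h) = 0 :> (V -> R).
    by apply: funext => q; rewrite big_nil.
  exact: is_diff_cst.
have -> : (fun q => \sum_(j <- i :: r) g j q) = g i + (fun q => \sum_(j <- r) g j q).
  by apply: funext => q; rewrite big_cons.
have -> : (fun h => \sum_(j <- i :: r) d j h) = d i + (fun q => \sum_(j <- r) d j q).
  by apply: funext => q; rewrite big_cons.
exact: is_diffD.
Qed.

Lemma is_diff_mul p g1 g2 d1 d2 : is_diff p g1 d1 -> is_diff p g2 d2 ->
  is_diff p (fun q => g1 q * g2 q) (fun h => g1 p * d2 h + g2 p * d1 h).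
Proof. by move=> h1 h2; exact: is_diffM. Qed.

Lemma is_diff_scale p (c : R) g d : is_diff p g d ->
  is_diff p (fun q => c * g q) (fun h => c * d h).
Proof. by move=> hg; exact: is_diffZ. Qed.

Lemma is_diff_real_comp p g d (phi : R -> R) (c : R) :
  is_diff p g d -> is_derive (g p) (1 : R) phi c ->
  is_diff p (fun q => phi (g q)) (fun h => c * d h).
Proof.
move=> hg hphi.
(* The one-variable derivative [c] is read as the linear map [h *: c], ready for the chain rule. *)
have dphi : is_diff (g p) phi (fun h => h *: c).
  have hd : derivable phi (g p) 1 by [].
  split; first exact/derivable1_diffP.
  by rewrite deriv1E // derive1E derive_val.
apply: is_diff_eq (is_diff_comp hg dphi) _.
by apply: funext => h /=; rewrite -[RHS]mulrC.
Qed.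

(* [d] is the differential of [ln \o g] at [p]; positivity is only needed at [p],
   so no neighbourhood has to be tracked when taking products and powers. *)
Definition is_logdiff p g d : Prop :=
  0 < g p /\ is_diff p g (fun h => g p * d h).

Lemma is_logdiff_eq p g d d' : is_logdiff p g d -> d =1 d' -> is_logdiff p g d'.
Proof. by move=> hd /funext <-. Qed.

Lemma is_logdiff_ln p g d : is_logdiff p g d -> is_diff p (fun q => ln (g q)) d.
Proof.
move=> [g0 hg]; apply: is_diff_eq (is_diff_real_comp hg (is_derive1_ln g0)) _.
by apply: funext => h; rewrite mulKf // gt_eqF.
Qed.

Lemma is_diff_logdiff p g d : 0 < g p -> is_diff p g d ->
  is_logdiff p g (fun h => d h / g p).
Proof.
move=> g0 hg; split=> //; apply: is_diff_eq hg _.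
by apply: funext => h; rewrite mulrC divfK // gt_eqF.
Qed.

Lemma is_logdiffM p g1 g2 d1 d2 : is_logdiff p g1 d1 -> is_logdiff p g2 d2 ->
  is_logdiff p (fun q => g1 q * g2 q) (fun h => d1 h + d2 h).
Proof.
move=> [g10 h1] [g20 h2]; split; first exact: mulr_gt0.
apply: is_diff_eq (is_diff_mul h1 h2) _.
by apply: funext => h; ring.
Qed.

Lemma is_logdiff_powR p g d (r : R) : is_logdiff p g d ->
  is_logdiff p (fun q => g q `^ r) (fun h => r * d h).
Proof.
move=> [g0 hg]; split; first exact: powR_gt0.
apply: is_diff_eq (is_diff_real_comp hg (is_derive1_powR r g0)) _.
(* The chain rule produces the exponent [r - 1]; since [g p] is positive, one factor [g p] can be
   split off so that both sides share that power. *)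
apply: funext => h; have -> : g p `^ r = g p `^ (r - 1) * g p.
  rewrite -{3}(powRr1 (ltW g0)) -powRD ?subrK //.
  by rewrite (gt_eqF g0) implybT.
by ring.
Qed.

Lemma is_logdiffV p g d : is_logdiff p g d ->
  is_logdiff p (fun q => (g q)^-1) (fun h => - d h).
Proof.
move=> [g0 hg]; split; first by rewrite invr_gt0.
have g0' : g p != 0 by rewrite gt_eqF.
have hV : is_derive (g p) (1 : R) GRing.inv (- (g p) ^- 2 * 1).
  exact: is_deriveV.
apply: is_diff_eq (is_diff_real_comp hg hV) _.
by apply: funext => h; field.
Qed.

Lemma is_logdiff_prod (I : Type) (r : seq I) p (g d : I -> V -> R) :
  (forall i, is_logdiff p (g i) (d i)) ->
  is_logdiff p (fun q => \prod_(i <- r) g i q) (fun h => \sum_(i <- r) d i h).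
Proof.
move=> hg; elim: r => [|i r IH].
  split; first by rewrite big_nil.
  have -> : (fun q => \prod_(i <- [::]) g i q) = cst 1.
    by apply: funext => q; rewrite big_nil.
  apply: is_diff_eq (is_diff_cst _ _) _.
  by apply: funext => h; rewrite !big_nil mulr0.
have -> : (fun q => \prod_(j <- i :: r) g j q) = (fun q => g i q * \prod_(j <- r) g j q).
  by apply: funext => q; rewrite big_cons.
have -> : (fun h => \sum_(j <- i :: r) d j h) = (fun h => d i h + \sum_(j <- r) d j h).
  by apply: funext => q; rewrite big_cons.
exact: is_logdiffM.
Qed.

End Differentials.

(** * Real differential of a Hermitian form *)

Section HermitianFormDifferential.
Local Open Scope sesquilinear_scope.
Context {R : realType} (n : nat).
Local Notation C := R[i].
Local Notation V := ('cV[R]_n * 'cV[R]_n)%type.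
Implicit Types (p q h : V) (A : 'M[C]_n) (u v w : 'cV[C]_n).

(** Left inverse of [reim], written so that [real_coord g p] is convertible to [g (of_reim p)]. *)
Definition of_reim p : 'cV[C]_n := \col_j (p.1 j 0 +i* p.2 j 0).

Lemma reimK : cancel (@reim R n) of_reim.
Proof. by move=> w; apply/colP => j; rewrite !mxE; case: (w j 0). Qed.

(** In real coordinates the form is a polynomial, so its differentiability reduces to that of the
    coordinate maps. *)
Lemma pformE A h p : pform A (of_reim h) (of_reim p) =
  \sum_j \sum_k (complex.Re (A j k) * (h.1 j 0 * p.1 k 0 + h.2 j 0 * p.2 k 0)
               + complex.Im (A j k) * (h.2 j 0 * p.1 k 0 - h.1 j 0 * p.2 k 0)).
Proof.
rewrite /pform -mulmxA mxE Re_sum.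
apply: eq_bigr => j _; rewrite !mxE mulr_sumr Re_sum.
apply: eq_bigr => k _; rewrite !mxE.
by case: (A j k) => a b /=; ring.
Qed.

Lemma is_diff_coord1 j p : is_diff p (fun q : V => q.1 j 0) (fun h => h.1 j 0).
Proof.
apply: is_diff_linear => [a u v|q]; first by rewrite /= !mxE.
apply: (@continuous_comp _ _ _ fst (fun M : 'cV[R]_n => M j 0)).
  exact: cvg_fst.
exact: coord_continuous.
Qed.

Lemma is_diff_coord2 j p : is_diff p (fun q : V => q.2 j 0) (fun h => h.2 j 0).
Proof.
apply: is_diff_linear => [a u v|q]; first by rewrite /= !mxE.
apply: (@continuous_comp _ _ _ snd (fun M : 'cV[R]_n => M j 0)).
  exact: cvg_snd.
exact: coord_continuous.
Qed.

Lemma is_diff_qform A p : A \is hermsymmx ->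
  is_diff p (fun q => qform A (of_reim q))
            (fun h => 2 * pform A (of_reim h) (of_reim p)).
Proof.
move=> hA.
have -> : (fun q => qform A (of_reim q)) = (fun q => \sum_j \sum_k
    (complex.Re (A j k) * (q.1 j 0 * q.1 k 0 + q.2 j 0 * q.2 k 0)
   + complex.Im (A j k) * (q.2 j 0 * q.1 k 0 - q.1 j 0 * q.2 k 0))).
  by apply: funext => q; exact: pformE.
have X := is_diff_coord1^~ p; have Y := is_diff_coord2^~ p.
have D := fun j k => is_diffD
  (is_diff_scale (complex.Re (A j k))
    (is_diffD (is_diff_mul (X j) (X k)) (is_diff_mul (Y j) (Y k))))
  (is_diff_scale (complex.Im (A j k))
    (is_diffB (is_diff_mul (Y j) (X k)) (is_diff_mul (X j) (Y k)))).
apply: is_diff_eq (is_diff_sum _ (fun j => is_diff_sum _ (D j))) _.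
apply: funext => h.
(* The product rule gives one term with [h] on the left and one with [h] on the right; symmetry of
   [pform] splits the factor 2 in the same way. *)
rewrite mulr_natl mulr2n -{1}(pform_sym _ _ hA) !pformE -big_split.
apply: eq_bigr => j _; rewrite -big_split; apply: eq_bigr => k _ /=.
rewrite !fctE /=; ring.
Qed.

End HermitianFormDifferential.

(** * Logarithmic differential of the objective and the stationarity criterion *)

Section Objective.
Local Open Scope sesquilinear_scope.
Context {R : realType} (K n : nat).
Local Notation C := R[i].
Implicit Types (A B : 'M[C]_n) (u v w : 'cV[C]_n).

(** [X_i] is the Gram matrix [e_i e_i^H]. *)
Lemma psdmx_Xmx (i : 'I_n) : psdmx (Xmx i : 'M[C]_n).
Proof.
suff -> : Xmx i = delta_mx i 0 *m (delta_mx i 0 : 'cV[C]_n) ^t*.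
  exact: psdmx_gram.
apply/matrixP => j k; rewrite !mxE big_ord1 !mxE eqxx andbT conjC_nat -natrM mulnb.
case: (eqVneq j k) => [->|jk] /=; first by rewrite andbT andbb.
case: (eqVneq j i) jk => [->|] //= jk.
by rewrite eq_sym (negbTE jk).
Qed.

Lemma sum_expR_gt0 (F : 'I_n -> R) : (0 < n)%N -> 0 < \sum_i expR (F i).
Proof.
move=> n0; rewrite (bigD1 (Ordinal n0)) //=.
by apply: ltr_pwDl; [exact: expR_gt0|apply: sumr_ge0 => i _; exact: expR_ge0].
Qed.

Variables (CC DD : 'I_K -> 'M[C]_n) (RS mu tau a1 a2 : R).
Hypotheses (CC_posdef : forall k, posdefmx (CC k)).
Hypotheses (DD_posdef : forall k, posdefmx (DD k)).
Hypotheses (RS_gt0 : 0 < RS) (mu_ge0 : 0 <= mu) (tau_gt0 : 0 < tau).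
Hypotheses (a1_gt0 : 0 < a1) (a2_gt0 : 0 < a2).

Local Notation lambda := (lambdaRIS CC DD RS mu tau a1 a2).
(** Choosing the constant scaling function 1 isolates the bracket of [Cbar]; [D1] does the same for
    [Dbar]. *)
Local Notation C1 := (Cbar CC RS mu tau a2 (fun=> 1)).
Local Notation D1 := (Dbar DD RS mu tau a1 (fun=> 1)).

Lemma ln2_gt0 : 0 < ln 2 :> R.
Proof. by rewrite ln_gt0 // ltr1n. Qed.

(** Ensures that the sums of exponentials are nonempty, hence positive. *)
Lemma cV_neq0_dim_gt0 w : w != 0 -> (0 < n)%N.
Proof.
by case: n w => // w /negP[]; apply/eqP/colP => -[].
Qed.

(** Stated for any nonzero [a], so that it serves both [a1] and [- a2]. *)
Lemma is_logdiff_expsum (a : R) p : of_reim p != 0 -> a != 0 ->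
  is_logdiff p (fun q => \sum_(i < n) expR (qform (Xmx i) (of_reim q) / a))
    (fun h => (\sum_(i < n) expR (qform (Xmx i) (of_reim p) / a) *
                 (2 / a * pform (Xmx i) (of_reim h) (of_reim p)))
              / \sum_(i < n) expR (qform (Xmx i) (of_reim p) / a)).
Proof.
move=> /cV_neq0_dim_gt0 n0 a0.
apply: is_diff_logdiff; first exact: sum_expR_gt0.
apply: is_diff_sum => i.
have hq := is_diff_scale a^-1 (is_diff_qform p (psdmx_Xmx i).1).
have := is_diff_real_comp hq (is_derive_expR _).
have -> : (fun q => expR (qform (Xmx i) (of_reim q) / a)) =
    (fun q => expR (a^-1 * qform (Xmx i) (of_reim q))).
  by apply: funext => q; rewrite mulrC.
move/is_diff_eq; apply; apply: funext => h.
by rewrite [qform _ _ / a]mulrC; ring.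
Qed.

Lemma pform_wsum m (c : 'I_m -> R) (A : 'I_m -> 'M[C]_n) u v :
  pform (\sum_i (c i)%:C *: A i) u v = \sum_i c i * pform (A i) u v.
Proof. by rewrite pform_sum; apply: eq_bigr => i _; exact: pformZ. Qed.

Lemma pform_C1 u v w : pform (C1 w) u v =
  (RS * ln 2)^-1 * (\sum_k (qform (CC k) w)^-1 * pform (CC k) u v)
  + mu / tau * ((\sum_(i < n) expR (qform (Xmx i) w / - a2))^-1 *
      \sum_(i < n) expR (qform (Xmx i) w / - a2) * pform (Xmx i) u v).
Proof.
(* [Cbar] divides [- q] by [a2], whereas [lambdaRIS] divides [q] by [- a2]. *)
have e i : - qform (Xmx i) w / a2 = qform (Xmx i) w / - a2.
  by rewrite invrN mulrN mulNr.
rewrite /Cbar scale1r pformD !pformZ !pform_wsum.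
by congr (_ + _ * (_^-1 * _)); apply: eq_bigr => i _; rewrite e.
Qed.

Lemma pform_D1 u v w : pform (D1 w) u v =
  (RS * ln 2)^-1 * (\sum_k (qform (DD k) w)^-1 * pform (DD k) u v)
  + mu / tau * ((\sum_(i < n) expR (qform (Xmx i) w / a1))^-1 *
      \sum_(i < n) expR (qform (Xmx i) w / a1) * pform (Xmx i) u v).
Proof. by rewrite /Dbar scale1r pformD !pformZ !pform_wsum. Qed.

(** Scalar core of the gradient computation, with [l] for [ln 2], [e1] and [e2] for the exponentials
    and [x] for the forms of the [X_i]. Each smoothing parameter in an exponent cancels the one from
    the inner derivative; the sign of [- b2] puts the second exponential sum on the [C1] side, while
    the first lands on the [D1] side. *)
Lemma lambdaRIS_logdiff_arith (l r m t b1 b2 : R)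
    (pC qC pD qD : 'I_K -> R) (e1 e2 x : 'I_n -> R) :
  r != 0 -> t != 0 -> b1 != 0 -> b2 != 0 -> l != 0 ->
  \sum_i e1 i != 0 -> \sum_i e2 i != 0 ->
  \sum_k r^-1 * (2 * pC k / qC k + - (2 * pD k / qD k))
  + - (b1 * m * l / t) * ((\sum_i e1 i * (2 / b1 * x i)) / \sum_i e1 i)
  + - (b2 * m * l / t) * ((\sum_i e2 i * (2 / - b2 * x i)) / \sum_i e2 i)
  = l * 2 * (((r * l)^-1 * (\sum_k (qC k)^-1 * pC k)
              + m / t * ((\sum_i e2 i)^-1 * \sum_i e2 i * x i))
           - ((r * l)^-1 * (\sum_k (qD k)^-1 * pD k)
              + m / t * ((\sum_i e1 i)^-1 * \sum_i e1 i * x i))).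
Proof.
move=> r0 t0 b10 b20 l0.
have expsum (b : R) (e : 'I_n -> R) :
    \sum_i e i * (2 / b * x i) = 2 / b * \sum_i e i * x i.
  by rewrite mulr_sumr; apply: eq_bigr => i _; ring.
have -> : \sum_k r^-1 * (2 * pC k / qC k + - (2 * pD k / qD k))
    = r^-1 * 2 * (\sum_k (qC k)^-1 * pC k - \sum_k (qD k)^-1 * pD k).
  by rewrite -sumrB mulr_sumr; apply: eq_bigr => k _; ring.
rewrite !expsum => S10 S20; field.
by rewrite r0 t0 b10 b20 l0 S10 S20.
Qed.

Lemma is_logdiff_lambdaRIS p : of_reim p != 0 ->
  is_logdiff p (real_coord lambda)
    (fun h => ln 2 * 2 * (pform (C1 (of_reim p)) (of_reim h) (of_reim p)
                          - pform (D1 (of_reim p)) (of_reim h) (of_reim p))).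
Proof.
move=> w0.
have hq A : posdefmx A -> is_logdiff p (fun q => qform A (of_reim q))
    (fun h => 2 * pform A (of_reim h) (of_reim p) / qform A (of_reim p)).
  by move=> [hA pA]; apply: is_diff_logdiff; [exact: pA|exact: is_diff_qform].
have hratio k := is_logdiff_powR RS^-1
  (is_logdiffM (hq _ (CC_posdef k)) (is_logdiffV (hq _ (DD_posdef k)))).
have a2N0 : - a2 != 0 by rewrite oppr_eq0 gt_eqF.
have a1N0 : a1 != 0 by rewrite gt_eqF.
have hd := is_logdiffM (is_logdiffM (is_logdiff_prod (index_enum 'I_K) hratio)
  (is_logdiff_powR (- (a1 * mu * ln 2 / tau)) (is_logdiff_expsum w0 a1N0)))
  (is_logdiff_powR (- (a2 * mu * ln 2 / tau)) (is_logdiff_expsum w0 a2N0)).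
apply: is_logdiff_eq hd _ => h.
have n0 := cV_neq0_dim_gt0 w0.
have eC := pform_C1 (of_reim h) (of_reim p) (of_reim p).
have eD := pform_D1 (of_reim h) (of_reim p) (of_reim p).
(* The forms of [C1] and [D1] on the right-hand side are expanded, making the goal an instance of
   the scalar identity. *)
apply: etrans (congr2 (fun c d => ln 2 * 2 * (c - d)) (esym eC) (esym eD)).
apply: lambdaRIS_logdiff_arith; first [exact: lt0r_neq0 | apply: lt0r_neq0].
- exact: ln2_gt0.
- exact: sum_expR_gt0.
- exact: sum_expR_gt0.
Qed.

(** Positivity is the first component of the logarithmic differential, taken at [reim w]. *)
Lemma lambdaRIS_gt0 w : w != 0 -> 0 < lambda w.
Proof.
move=> w0; have : of_reim (reim w) != 0 by rewrite reimK.
by move/is_logdiff_lambdaRIS => [+ _]; rewrite /real_coord -/(of_reim _) reimK.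
Qed.

Lemma unitmx_D1 w : (0 < K)%N -> w != 0 -> D1 w \in unitmx.
Proof.
move=> K0 w0; apply: unitmx_qform_gt0 => v v0.
rewrite /qform -/(pform _ v v) pform_D1.
apply: ltr_wpDr.
  apply: mulr_ge0; first by rewrite divr_ge0 // ltW.
  have n0 := cV_neq0_dim_gt0 w0.
  apply: mulr_ge0; first by rewrite invr_ge0 ltW // sum_expR_gt0.
  apply: sumr_ge0 => i _; apply: mulr_ge0; first exact: expR_ge0.
  exact: (qform_ge0 v (psdmx_Xmx i)).
apply: mulr_gt0; first by rewrite invr_gt0 mulr_gt0 // ln2_gt0.
have hpos k : 0 < (qform (DD k) w)^-1 * pform (DD k) v v.
  have [_ hD] := DD_posdef k.
  by apply: mulr_gt0; [rewrite invr_gt0; exact: hD|exact: hD].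
(* Since [0 < K], the index 0 supplies a strictly positive summand. *)
rewrite (bigD1 (Ordinal K0)) //=.
by apply: ltr_pwDl => //; apply: sumr_ge0 => k _; exact: ltW.
Qed.

Lemma is_diff_LRIS_eq0 p : of_reim p != 0 ->
  C1 (of_reim p) *m of_reim p = D1 (of_reim p) *m of_reim p ->
  is_diff p (real_coord (LRIS CC DD RS mu tau a1 a2)) (fun=> 0).
Proof.
move=> w0 CD.
have h1 := is_diff_scale (ln 2)^-1 (is_logdiff_ln (is_logdiff_lambdaRIS w0)).
have -> : real_coord (LRIS CC DD RS mu tau a1 a2) =
    (fun q => (ln 2)^-1 * ln (real_coord lambda q)).
  by apply: funext => q; exact: mulrC.
apply: is_diff_eq h1 _; apply: funext => h.
have e := pform_eqr (of_reim h) CD.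
apply: etrans (congr1 (fun c => (ln 2)^-1 * (ln 2 * 2 * (c - _))) e) _.
by rewrite subrr !mulr0.
Qed.

Lemma stationary_of_C1_eq_D1 w : w != 0 -> C1 w *m w = D1 w *m w ->
  wirtinger_stationary (LRIS CC DD RS mu tau a1 a2) w.
Proof.
move=> w0 CD; have := @is_diff_LRIS_eq0 (reim w); rewrite reimK => /(_ w0 CD) dL.
split; first exact: ex_diff.
apply/colP => j; rewrite [LHS]mxE [RHS]mxE.
rewrite !deriveE; try exact: ex_diff.
(* The partial derivatives are values of the zero differential, so the entry is
   [2^-1 * (0 +i* 0)]. *)
by rewrite diff_val; exact: mulr0.
Qed.

(** Multiplying the eigenvalue equation by [b B] gives [a A w = l b B w = a B w], and the scalar [a]
    cancels. *)
Lemma eq_of_pencil_eigen A B (a b l : C) w : l != 0 -> l = a / b ->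
  B \in unitmx -> invmx (b *: B) *m (a *: A) *m w = l *: w ->
  A *m w = B *m w.
Proof.
move=> l0 lE Bu eigen.
(* Division by 0 returns 0, so [b = 0] would contradict [l != 0]. *)
have b0 : b != 0 by apply: contraNneq l0 => b0; rewrite lE b0 invr0 mulr0.
have a0 : a != 0 by apply: contraNneq l0 => a0; rewrite lE a0 mul0r.
have bBu : b *: B \in unitmx by rewrite unitmxZ // unitfE.
apply: (scalerI a0).
have := congr1 (mulmx (b *: B)) eigen.
rewrite !mulmxA mulmxV // mul1mx -!scalemxAl -scalemxAr scalerA.
by rewrite lE mulrC divfK.
Qed.

Lemma CbarE num w : Cbar CC RS mu tau a2 num w = num w *: C1 w.
Proof. by rewrite /Cbar; congr (_ *: _); exact/esym/scale1r. Qed.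

Lemma DbarE den w : Dbar DD RS mu tau a1 den w = den w *: D1 w.
Proof. by rewrite /Dbar; congr (_ *: _); exact/esym/scale1r. Qed.

(** Positivity of [lambda] makes both [num w] and [den w] nonzero, and [D1 w] is invertible, so the
    eigenvalue equation reduces to [C1 w *m w = D1 w *m w]. *)
Lemma stationary_of_eigen (num den : 'cV[C]_n -> C) w : (0 < K)%N -> w != 0 ->
  (lambda w)%:C = num w / den w ->
  invmx (Dbar DD RS mu tau a1 den w) *m Cbar CC RS mu tau a2 num w *m w
    = (lambda w)%:C *: w ->
  wirtinger_stationary (LRIS CC DD RS mu tau a1 a2) w.
Proof.
move=> K0 w0 lamE eigen; apply: stationary_of_C1_eq_D1; first exact: w0.
have lam0 : (lambda w)%:C != 0 by rewrite gt_eqF // ltcR lambdaRIS_gt0.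
apply: (eq_of_pencil_eigen lam0 lamE (unitmx_D1 K0 w0)).
by move: eigen; rewrite CbarE DbarE.
Qed.

End Objective.

Theorem lemma2 (R : realType) (N K L M : nat)
  (N_gt0 : (0 < N)%N) (K_gt0 : (0 < K)%N) (L_gt0 : (0 < L)%N) (M_gt0 : (0 < M)%N)
  (sigma2 P : R) (sigma2_gt0 : 0 < sigma2) (P_gt0 : 0 < P)
  (H : 'I_K -> 'I_L -> 'M[R[i]]_(N, M))
  (Rerr : 'I_K -> 'I_L -> 'M[R[i]]_(M * N)) (Rerr_psd : forall k l, psdmx (Rerr k l))
  (f : 'I_K -> 'cV[R[i]]_N)
  (RS mu tau a1 a2 : R) (RS_gt0 : 0 < RS) (mu_ge0 : 0 <= mu)
  (tauE : tau = ((L * M)%:R)^-1) (a1_gt0 : 0 < a1) (a2_gt0 : 0 < a2)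
  (num den : 'cV[R[i]]_(L * M) -> R[i]) :
  let CC := Cmx sigma2 P H Rerr f in
  let DD := Dmx sigma2 P H Rerr f in
  let lambda := lambdaRIS CC DD RS mu tau a1 a2 in
  (forall v : 'cV[R[i]]_(L * M), v != 0 -> (lambda v)%:C = num v / den v) ->
  forall w : 'cV[R[i]]_(L * M), w != 0 ->
  invmx (Dbar DD RS mu tau a1 den w) *m Cbar CC RS mu tau a2 num w *m w
    = (lambda w)%:C *: w ->
  wirtinger_stationary (LRIS CC DD RS mu tau a1 a2) w.
Proof.
move=> CC DD lambda lamE w w0; apply: stationary_of_eigen => //.
- by move=> k; exact: posdefmx_Cmx.
- by move=> k; exact: posdefmx_Dmx.
- by rewrite tauE invr_gt0 ltr0n muln_gt0 L_gt0.
- exact: lamE.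
Qed.
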